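(* There exists an absolute constant $c>0$ such that for every integer $k\geq1$ and every integer $n$ sufficiently large relative to $k$, $s_k(n)\geq c\,kn\log n$.
   Context: A graph $U$ contains a graph $G$ if some subgraph of $U$ is isomorphic to $G$. For integers $k\geq1$ and $n\geq1$, $s_k(n)$ denotes the minimum number of edges in a graph that contains every graph with $n$ vertices and treewidth at most $k$. *)

(* Defs.v *)
From mathcomp Require Import all_boot.
From mathcomp Require Import boolp.

Set Implicit Arguments.
Unset Strict Implicit.
Unset Printing Implicit Defensive.

(* Finite simple graphs. *)
Record sgraph := SGraph {
  vertex :> finType;
  adj : rel vertex;
  adj_sym : symmetric adj;
  adj_irr : irreflexive adj }.

Arguments adj {s}.

Definition edges (G : sgraph) : {set {set G}} :=
  [set [set x; y] | x in G, y in G & adj x y].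

Definition isomorphic (G H : sgraph) : Prop :=
  exists f : G -> H, bijective f /\ (forall x y, adj (f x) (f y) = adj x y).

Record subgraph (U : sgraph) := Subgraph {
  sub_verts : {set U};
  sub_rel : rel U;
  sub_rel_sym : symmetric sub_rel;
  sub_rel_verts : forall x y, sub_rel x y -> (x \in sub_verts) && (y \in sub_verts);
  sub_rel_adj : subrel sub_rel adj }.

Definition sub_adj (U : sgraph) (S : subgraph U) : rel {x | x \in sub_verts S} :=
  [rel x y | sub_rel S (val x) (val y)].

Lemma sub_adj_sym (U : sgraph) (S : subgraph U) : symmetric (@sub_adj U S).
Proof. by move=> x y; exact: sub_rel_sym. Qed.

Lemma sub_adj_irr (U : sgraph) (S : subgraph U) : irreflexive (@sub_adj U S).
Proof.
move=> x; apply/negP => /= /sub_rel_adj.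
by rewrite adj_irr.
Qed.

Definition sgraph_of_subgraph (U : sgraph) (S : subgraph U) : sgraph :=
  SGraph (@sub_adj_sym U S) (@sub_adj_irr U S).

Coercion sgraph_of_subgraph : subgraph >-> sgraph.

Definition contains (U G : sgraph) : Prop :=
  exists S : subgraph U, isomorphic G S.

Definition connected (G : sgraph) : Prop :=
  0 < #|G| /\ forall x y : G, connect adj x y.

(* [cycle adj [:: x; y]] holds for adjacent x and y, hence the bound 2 < size c. *)
Definition acyclic (G : sgraph) : Prop :=
  forall c : seq G, 2 < size c -> ~ ucycle adj c.

Definition is_tree (G : sgraph) : Prop := connected G /\ acyclic G.

Record tree_decomposition (G : sgraph) := TreeDecomposition {
  td_tree : sgraph;
  td_treeP : is_tree td_tree;
  td_bag : td_tree -> {set G};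
  td_vertex : forall v : G, exists t, v \in td_bag t;
  td_edge : forall u v : G, adj u v ->
    exists t, (u \in td_bag t) && (v \in td_bag t);
  (* the nodes whose bags contain v induce a connected subgraph of the tree *)
  td_connected : forall (v : G) (s t : td_tree),
    v \in td_bag s -> v \in td_bag t ->
    connect [rel a b | [&& adj a b, v \in td_bag a & v \in td_bag b]] s t }.

(* With truncated subtraction the graph without vertices gets width 0, not -1. *)
Definition td_width (G : sgraph) (D : tree_decomposition G) : nat :=
  (\max_(t : td_tree D) #|td_bag t|).-1.

Definition least (P : nat -> Prop) (exP : exists n, P n) : nat :=
  @ex_minn (fun n => `[< P n >])
    (let: ex_intro n Pn := exP in ex_intro _ n (asboolT Pn)).

Lemma leastP (P : nat -> Prop) (exP : exists n, P n) :
  P (least exP) /\ forall m, P m -> least exP <= m.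
Proof.
rewrite /least; case: ex_minnP => m /asboolP Pm min_m.
by split=> // j Pj; apply: min_m; apply/asboolP.
Qed.

Definition K1_adj : rel unit := fun _ _ => false.

Definition K1 : sgraph :=
  @SGraph unit K1_adj (fun _ _ => erefl) (fun _ => erefl).

Lemma K1_tree : is_tree K1.
Proof.
split; first by split=> [|[] []]; rewrite ?card_unit ?connect0.
by move=> [|[] [|[] c]].
Qed.

Lemma exists_tree_decomposition_width (G : sgraph) :
  exists w, exists D : tree_decomposition G, td_width D = w.
Proof.
unshelve eexists; last first.
- unshelve eexists; last by [].
  apply: (@TreeDecomposition G K1 K1_tree (fun _ => [set: G])).
  + by move=> v; exists tt; rewrite inE.
  + by move=> u v _; exists tt; rewrite !inE.
  + by move=> v [] [] _ _; exact: connect0.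
Qed.

Definition treewidth (G : sgraph) : nat :=
  least (exists_tree_decomposition_width G).

Definition universal_tw (k n : nat) (U : sgraph) : Prop :=
  forall G : sgraph, #|G| = n -> treewidth G <= k -> contains U G.

Definition complete_adj (n : nat) : rel 'I_n := fun x y => x != y.

Lemma complete_sym n : symmetric (@complete_adj n).
Proof. by move=> x y; rewrite /complete_adj eq_sym. Qed.

Lemma complete_irr n : irreflexive (@complete_adj n).
Proof. by move=> x; rewrite /complete_adj eqxx. Qed.

Definition complete (n : nat) : sgraph :=
  SGraph (@complete_sym n) (@complete_irr n).

Lemma complete_contains (n : nat) (G : sgraph) :
  #|G| = n -> contains (complete n) G.
Proof.
move=> <-.
pose r : rel (complete #|G|) := fun i j => adj (enum_val i : G) (enum_val j : G).
have rsym : symmetric r by move=> i j; exact: adj_sym.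
have rv (i j : complete #|G|) : r i j -> (i \in [set: complete #|G|]) && (j \in [set: complete #|G|]).
  by rewrite !inE.
have radj : subrel r adj.
  by move=> i j; apply: contraTneq => ->; rewrite /r adj_irr.
exists (Subgraph rsym rv radj).
exists (fun x => exist _ (enum_rank x : complete #|G|) (in_setT _)); split.
  exists (fun s => enum_val (val s)) => [x|s] /=; first exact: enum_rankK.
  by apply: val_inj => /=; exact: enum_valK.
by move=> x y; rewrite /= /sub_adj /= /r !enum_rankK.
Qed.

Lemma exists_universal_tw (k n : nat) :
  exists m, exists U : sgraph, universal_tw k n U /\ #|edges U| = m.
Proof.
exists #|edges (complete n)|; exists (complete n); split=> // G cardG _.
exact: complete_contains.
Qed.

(* The minimum number of edges of a graph, on any finite vertex type, containing
   every graph with n vertices and treewidth at most k. *)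
Definition s_tw (k n : nat) : nat := least (exists_universal_tw k n).

(* Main.v *)
Require Import Defs.
From HB Require Import structures.
From mathcomp Require Import all_boot all_order all_algebra.
From mathcomp Require Import boolp reals exp.
From mathcomp Require Import zify lra.

Set Implicit Arguments.
Unset Strict Implicit.
Unset Printing Implicit Defensive.

Import Order.TTheory GRing.Theory Num.Theory.
Local Open Scope ring_scope.

(* The disjoint union of n/s copies of K_{k,s-k} has treewidth at most k, so a
   universal graph has at least k(n/s) vertices of degree at least s - k.
   Summing over s from k+1 to n, the degrees of the universal graph add up to
   at least k(n/(k+1) + ... + n/n), which is of order k n log n. *)

Local Open Scope nat_scope.

(** * Edges and degree counts *)

Definition degree (U : sgraph) (v : U) : nat := #|adj v|.

(** The map from ordered adjacent pairs to edges, forgetting the order, has fibres of size at most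
    two. *)
Lemma sum_degree_le (U : sgraph) : \sum_(v : U) degree v <= 2 * #|edges U|.
Proof.
pose P : {set U * U} := [set p | adj p.1 p.2].
have -> : \sum_(v : U) degree v = #|P|.
  rewrite -sum1_card /degree (eq_bigl (fun p => adj p.1 p.2)); last first.
    by move=> p; rewrite inE.
  rewrite -(pair_big_dep predT (fun x y : U => adj x y) (fun _ _ => 1)) /=.
  by apply: eq_bigr => v _; rewrite sum1_card.
pose f (p : U * U) := [set p.1; p.2].
have fP p : p \in P -> f p \in edges U.
  by case: p => x y; rewrite inE => xy; apply/imset2P; exists x y; rewrite ?inE.
rewrite -sum1_card (partition_big f (mem (edges U))) //= mulnC -sum_nat_const.
apply: leq_sum => e /imset2P[a b _ _ ->]; rewrite sum1_card.
apply: leq_trans (card_size [:: (a, b); (b, a)]).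
apply/subset_leq_card/subsetP => -[x y].
rewrite unfold_in inE /= => /andP[adj_xy /eqP eq_ab].
have neq_xy : x != y by apply: contraTneq adj_xy => ->; rewrite adj_irr.
have /set2P[x_eq|x_eq] : x \in [set a; b] by rewrite -eq_ab set21.
  have /set2P[y_eq|y_eq] : y \in [set a; b] by rewrite -eq_ab set22.
    by rewrite x_eq y_eq eqxx in neq_xy.
  by rewrite x_eq y_eq mem_head.
have /set2P[y_eq|y_eq] : y \in [set a; b] by rewrite -eq_ab set22.
  by rewrite x_eq y_eq !inE eqxx orbT.
by rewrite x_eq y_eq eqxx in neq_xy.
Qed.

(** Double counting: a vertex [v] is counted once for each [t < m] below its degree, hence at most
    [degree v] times. *)
Lemma sum_card_degree_le (U : sgraph) (m : nat) :
  \sum_(t < m) #|[set v : U | t < degree v]| <= \sum_(v : U) degree v.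
Proof.
under [leqLHS]eq_bigr do rewrite -sum1dep_card big_mkcond.
rewrite exchange_big /=; apply: leq_sum => v _.
rewrite -big_mkcond /= sum1_card.
rewrite -[leqRHS]card_ord.
case: (posnP (degree v)) => [d0|d_gt0].
  by rewrite eq_card0 // => t; rewrite inE d0.
pose f (t : 'I_m) : 'I_(degree v) := insubd (Ordinal d_gt0) (t : nat).
have f_inj : {in [pred t : 'I_m | t < degree v] &, injective f}.
  move=> t u; rewrite !inE => lt_t lt_u /(congr1 val).
  by rewrite !val_insubd lt_t lt_u => /val_inj.
by rewrite -(card_in_image f_inj) max_card.
Qed.

(** * Paths as trees *)

Section PathGraph.
Variable n : nat.

Definition path_adj : rel 'I_n := fun a b => (a.+1 == b) || (b.+1 == a).

Lemma path_adj_sym : symmetric path_adj.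
Proof. by move=> a b; rewrite /path_adj orbC. Qed.

Lemma path_adj_irr : irreflexive path_adj.
Proof. by move=> a; rewrite /path_adj; lia. Qed.

Definition path_graph : sgraph := SGraph path_adj_sym path_adj_irr.

(** Walk upwards from [a] to [b] one vertex at a time. The predicate [P] serves both for
    connectedness of the whole path and for the bags containing a given vertex. *)
Lemma connect_path_graph (P : pred 'I_n) (a b : 'I_n) :
    (forall c : 'I_n, a <= c <= b -> P c) -> a <= b ->
  connect [rel x y | [&& path_adj x y, P x & P y]] a b.
Proof.
move=> Pab le_ab; have [d] := ubnPeq (b - a).
elim: d a Pab le_ab => [|d IHd] a Pab le_ab def_d.
  have -> : a = b by apply: val_inj => /=; lia.
  exact: connect0.
have lt_a1 : a.+1 < n by have := ltn_ord b; lia.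
apply: (connect_trans (y := Ordinal lt_a1)).
  by apply: connect1; rewrite /= /path_adj /= eqxx !Pab //=; lia.
apply: IHd => /= [c le_c||]; [apply: Pab|..]; lia.
Qed.

(* Both neighbours on a cycle of its largest vertex would be its predecessor. *)
Lemma path_graph_acyclic : acyclic path_graph.
Proof.
move=> c size_c /andP[cyc_c uniq_c].
have [x0 x0c] : exists x : path_graph, x \in c.
  by case: c size_c {cyc_c uniq_c} => // x c _; exists x; rewrite mem_head.
have [x xc max_x] := arg_maxnP (fun i : 'I_n => i : nat) x0c.
(* Rotated to start at its largest vertex [x], the cycle reads x, y, ..., z, and uniqueness forbids
   y = z. *)
have [i c' def_c] := rot_to xc.
have c'c : {subset x :: c' <= c} by move=> y; rewrite -def_c mem_rot.
move: cyc_c uniq_c size_c; rewrite -(rot_cycle i) -(rot_uniq i) -(size_rot i).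
rewrite def_c; case: c' c'c {def_c} => [|y c'] //= c'c.
case/lastP: c' c'c => [|c' z] //= c'c /andP[adj_xy].
rewrite rcons_path last_rcons => /andP[_ adj_zx] /and3P[_ y_c' _] _.
have le_y : (y : nat) <= x by apply: max_x; apply: c'c; rewrite !inE eqxx orbT.
have le_z : (z : nat) <= x.
  by apply: max_x; apply: c'c; rewrite !inE mem_rcons mem_head !orbT.
move: adj_xy adj_zx; rewrite /= /path_adj.
move=> adj_xy adj_zx; case/negP: y_c'; rewrite mem_rcons.
suff -> : y = z by rewrite mem_head.
by apply: val_inj => /=; lia.
Qed.

Lemma path_graph_tree : 0 < n -> is_tree path_graph.
Proof.
move=> n_gt0; split; last exact: path_graph_acyclic.
split=> [|a b]; first by rewrite card_ord.
wlog le_ab : a b / a <= b => [wlog_le|].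
  case/orP: (leq_total a b); first exact: wlog_le.
  by move/wlog_le; rewrite (sym_connect_sym path_adj_sym).
have := @connect_path_graph predT a b (fun _ _ => isT) le_ab.
by apply: connect_sub => x y /and3P[xy _ _]; exact: connect1.
Qed.

End PathGraph.

(** * Disjoint bicliques and their treewidth *)

Section Bicliques.
Variables k n s : nat.

(* Cutting 'I_n into blocks of s consecutive vertices, the first k vertices of
   each block are joined to the other ones; a last incomplete block is allowed. *)
Definition bicliques_adj : rel 'I_n :=
  fun u v => (u %/ s == v %/ s) && ((u %% s < k) != (v %% s < k)).

Lemma bicliques_adj_sym : symmetric bicliques_adj.
Proof. by move=> u v; rewrite /bicliques_adj eq_sym [X in _ && ~~ X]eq_sym. Qed.

Lemma bicliques_adj_irr : irreflexive bicliques_adj.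
Proof. by move=> u; rewrite /bicliques_adj !eqxx. Qed.

Definition bicliques : sgraph := SGraph bicliques_adj_sym bicliques_adj_irr.

Definition bicliques_bag (t : path_graph n) : {set bicliques} :=
  t |: [set u : 'I_n | (u %/ s == t %/ s) && (u %% s < k)].

Lemma card_bicliques_bag t : #|bicliques_bag t| <= k.+1.
Proof.
rewrite /bicliques_bag cardsU1 -[k.+1]add1n leq_add ?leq_b1 //.
set A := [set u : 'I_n | _].
case: (posnP k) => [k0|k_gt0].
  by rewrite eq_card0 // => u; rewrite !inE k0 ltn0 andbF.
(* Inside one block a vertex is determined by its residue; the default of [insubd] is never reached
   on [A]. *)
pose f (u : 'I_n) : 'I_k := insubd (Ordinal k_gt0) (u %% s).
have f_inj : {in A &, injective f}.
  move=> u v; rewrite !inE => /andP[/eqP ut lt_u] /andP[/eqP vt lt_v].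
  move/(congr1 val); rewrite !val_insubd lt_u lt_v => eq_mod.
  by apply: val_inj; rewrite /= (divn_eq u s) (divn_eq v s) ut vt eq_mod.
by rewrite -(card_in_imset f_inj) -[leqRHS]card_ord max_card.
Qed.

(** The bags form a path decomposition. An edge lies in the bag of its end outside the first [k] of
    the block. Such an end occurs in its own bag only, while one of the first [k] occurs in all bags
    of its block, which is an interval of the path. *)
Lemma treewidth_bicliques : 0 < n -> treewidth bicliques <= k.
Proof.
move=> n_gt0.
have bag_vertex (v : bicliques) : exists t, v \in bicliques_bag t.
  by exists v; rewrite !inE eqxx.
have bag_edge (u v : bicliques) : adj u v ->
    exists t, (u \in bicliques_bag t) && (v \in bicliques_bag t).
  wlog lt_u : u v / u %% s < k => [wlog_lt adj_uv|].
    have [/wlog_lt|le_u] := ltnP (u %% s) k; first exact.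
    have lt_v : v %% s < k.
      move: adj_uv; rewrite /= /bicliques_adj ltnNge le_u.
      by case: (v %% s < k); rewrite ?andbF.
    have [|t] := wlog_lt v u lt_v; first by rewrite adj_sym.
    by rewrite andbC; exists t.
  case/andP=> /eqP eq_div _; exists v.
  by rewrite !inE eqxx eq_div eqxx lt_u orbT.
have bag_connected (v : bicliques) (a b : path_graph n) :
    v \in bicliques_bag a -> v \in bicliques_bag b ->
  connect [rel x y | [&& adj x y, v \in bicliques_bag x
                                 & v \in bicliques_bag y]] a b.
  wlog le_ab : a b / (a : 'I_n) <= (b : 'I_n) => [wlog_le va vb|].
    case/orP: (leq_total (a : 'I_n) (b : 'I_n)) => [/wlog_le|/wlog_le ba].
      exact.
    rewrite sym_connect_sym ?ba // => x y /=.
    by rewrite path_adj_sym [X in _ && X]andbC.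
  move=> va vb; apply: connect_path_graph le_ab => c /andP[le_ac le_cb].
  move: va vb; rewrite !inE.
  have [lt_v|le_v] := ltnP (v %% s) k; rewrite ?andbT ?andbF ?orbF.
    have eq_div (x : 'I_n) : (v == x) || (v %/ s == x %/ s) -> v %/ s = x %/ s.
      by case/orP=> /eqP->.
    move=> /eq_div va /eq_div vb; apply/orP; right.
    have le_acs := leq_div2r s le_ac; have le_cbs := leq_div2r s le_cb.
    rewrite -va in le_acs; rewrite -vb in le_cbs.
    by rewrite eqn_leq le_acs le_cbs.
  move=> /eqP va /eqP vb; apply/eqP/val_inj.
  by move: le_ac le_cb; rewrite -va -vb /=; lia.
pose D := TreeDecomposition (path_graph_tree n_gt0) bag_vertex bag_edge bag_connected.
apply: (@leq_trans (td_width D)).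
  by rewrite /treewidth; apply: (leastP _).2; exists D.
rewrite /td_width -subn1 leq_subLR add1n.
by apply/bigmax_leqP => t _; exact: card_bicliques_bag.
Qed.

End Bicliques.

(** * Vertices of large degree in a universal graph *)

Lemma contains_embedding (U G : sgraph) : contains U G ->
  exists g : G -> U, injective g /\ forall x y, adj x y -> adj (g x) (g y).
Proof.
case=> S [f [f_bij f_adj]]; exists (fun x => val (f x)); split.
  by move=> x y /val_inj /(bij_inj f_bij).
by move=> x y xy; apply: (@sub_rel_adj _ S); have := f_adj x y; rewrite xy.
Qed.

Lemma card_degree_universal (k n t : nat) (U : sgraph) : universal_tw k n U ->
  k * (n %/ (t + k.+1)) <= #|[set v : U | t < degree v]|.
Proof.
move=> univ_U; have [->|n_gt0] := posnP n; first by rewrite div0n muln0.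
(* This block size leaves s - k = t + 1 neighbours to each of the first [k] vertices of a complete
   block, and there are [q] complete blocks. *)
set s := t + k.+1; set q := n %/ s.
have [g [g_inj g_adj]] := contains_embedding
  (univ_U (bicliques k n s) (card_ord n) (treewidth_bicliques k s n_gt0)).
have lt_n (i : 'I_q) (j : 'I_s) : i * s + j < n.
  have := leq_divM n s; have := ltn_ord i; have := ltn_ord j.
  by rewrite -/q; nia.
pose x i j : bicliques k n s := Ordinal (lt_n i j).
have s_gt0 : 0 < s by rewrite /s; lia.
have x_div i j : x i j %/ s = i by rewrite /= divnMDl // divn_small ?addn0.
have x_mod i j : x i j %% s = j by rewrite /= modnMDl modn_small.
have le_ks : k <= s by rewrite /s; lia.
(* The images of the first [k] vertices of all complete blocks: k q distinct vertices of [U]. *)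
pose h (p : 'I_k * 'I_q) := g (x p.2 (widen_ord le_ks p.1)).
have h_inj : injective h.
  move=> [j i] [j' i'] /g_inj /= eq_x.
  have eq_i : i' = i.
    by apply: ord_inj; rewrite -(x_div i (widen_ord le_ks j)) eq_x x_div.
  have eq_j : widen_ord le_ks j' = widen_ord le_ks j.
    by apply: ord_inj; rewrite -(x_mod i (widen_ord le_ks j)) eq_x x_mod.
  by rewrite eq_i; congr pair; apply: ord_inj; case: eq_j.
have -> : k * q = #|[set h p | p in [set: 'I_k * 'I_q]]|.
  by rewrite card_imset // cardsT card_prod !card_ord.
apply/subset_leq_card/subsetP => _ /imsetP[[j i] _ ->]; rewrite inE /degree.
have lt_s (l : 'I_t.+1) : k + l < s by rewrite /s; have := ltn_ord l; lia.
(* The images of the other t + 1 vertices of block [i], all adjacent to [h (j, i)]. *)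
pose e (l : 'I_t.+1) := g (x i (Ordinal (lt_s l))).
have e_inj : injective e.
  move=> l l' /g_inj eq_x; apply: val_inj => /=.
  by have := x_mod i (Ordinal (lt_s l)); rewrite eq_x x_mod /=; lia.
rewrite -[t.+1]card_ord -(card_imset _ e_inj).
apply/subset_leq_card/subsetP => _ /imsetP[l _ ->].
rewrite unfold_in; apply: g_adj.
rewrite /= /bicliques_adj !x_div !x_mod eqxx /= ltn_ord.
by rewrite ltnNge leq_addr.
Qed.

Lemma universal_edges (k n : nat) (U : sgraph) : universal_tw k n U ->
  k * \sum_(k.+1 <= s < n.+1) n %/ s <= 2 * #|edges U|.
Proof.
move=> univ_U; apply: leq_trans (sum_degree_le U).
apply: leq_trans (sum_card_degree_le U (n.+1 - k.+1)).
(* The substitution s = t + k + 1 turns block sizes into degree thresholds. *)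
rewrite -[k.+1]add0n big_addn big_mkord big_distrr /= add0n.
by apply: leq_sum => t _; exact: card_degree_universal.
Qed.

(** * Harmonic sums and the final estimate *)

Local Open Scope ring_scope.

(** Telescoping, with ln (s + 1) - ln s = ln (1 + 1/s) <= 1/s. *)
Lemma ln_sum_inv (R : realType) (a b : nat) : (0 < a <= b)%N ->
  ln b%:R - ln a%:R <= \sum_(a <= s < b) s%:R^-1 :> R.
Proof.
case/andP=> a_gt0 le_ab.
rewrite -(telescope_sumr (fun s => ln s%:R : R)) //.
rewrite !big_nat; apply: ler_sum => s /andP[le_as _].
have s_gt0 : 0 < s%:R :> R by rewrite ltr0n (leq_trans a_gt0).
rewrite -ln_div ?posrE // -natr1 mulrDl divff ?gt_eqF // mul1r.
by apply: le_ln1Dx; rewrite (lt_trans (ltrN10 R)) // invr_gt0.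
Qed.

(** The quotient q is at least 1, so n < (q + 1) s <= 2 q s. *)
Lemma divn_ge_half (R : realType) (n s : nat) : (0 < s <= n)%N ->
  n%:R / 2 * s%:R^-1 <= (n %/ s)%:R :> R.
Proof.
case/andP=> s_gt0 le_sn.
rewrite ler_pdivrMr ?ltr0n // ler_pdivrMr // -!natrM ler_nat.
have q_gt0 : (0 < n %/ s)%N by rewrite divn_gt0.
by have := ltn_ceil n s_gt0; nia.
Qed.

Theorem theorem4p1 (R : realType) :
  exists c : R, 0 < c /\
    forall k : nat, (1 <= k)%N ->
      exists N : nat, forall n : nat, (N <= n)%N ->
        c * k%:R * n%:R * ln (n%:R : R) <= (s_tw k n)%:R.
Proof.
(* Three factors 2 are lost: in the degree sum, in rounding n / s down, and in replacing ln n - ln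
   (k + 1) by half of ln n. *)
exists (8^-1); split; first by rewrite invr_gt0.
(* The bound n >= (k + 1)^2 says exactly that ln (k + 1) is at most half of ln n. *)
move=> k k_gt0; exists (k.+1 ^ 2)%N => n le_n; rewrite /s_tw.
have [[U [univ_U <-]] _] := leastP (exists_universal_tw k n).
have lt_kn : (k < n)%N by nia.
have n_gt0 : (0 < n)%N by lia.
have ln_n : 2 * ln k.+1%:R <= ln n%:R :> R.
  by rewrite mulr_natl -lnXn ?ltr0n // -natrX ler_ln ?posrE ?ltr0n ?ler_nat ?expn_gt0.
have ln_n1 : ln n%:R <= ln n.+1%:R :> R by rewrite ler_ln ?posrE ?ltr0n ?ler_nat.
have le_sum : n%:R / 2 * (ln n%:R / 2) <= (\sum_(k.+1 <= s < n.+1) n %/ s)%:R :> R.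
  have ln_sum : ln n%:R / 2 <= \sum_(k.+1 <= s < n.+1) s%:R^-1 :> R.
    have := @ln_sum_inv R k.+1 n.+1; rewrite !ltnS => /(_ (ltnW lt_kn)); lra.
  apply: le_trans (ler_wpM2l _ ln_sum) _; first by rewrite divr_ge0.
  rewrite mulr_sumr natr_sum !big_nat; apply: ler_sum => s /andP[lt_ks le_sn].
  by apply: divn_ge_half; rewrite (leq_trans _ lt_ks).
have := universal_edges univ_U; rewrite -(ler_nat R) !natrM => le_edges.
have := ler_wpM2l (ler0n R k) le_sum; lra.
Qed.
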